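(* Let $(H,\lhd,K)$ be a right Hopf module, where $H$ and $K$ are cocommutative Hopf algebras over a field. For linear maps $A,B\colon H\to K$ define the linear map $A\# B\colon H\to K$ by $$(A\# B)(f)=A\Big(f_{(1)}\lhd \mathcal S_K\big(B(f_{(2)})_{(1)}\big)\Big)\,B(f_{(2)})_{(2)},\qquad f\in H .$$ Then $\#$ is a bilinear associative product on the space of linear maps from $H$ to $K$, and its unit is the convolution unit $\eta_K\circ\varepsilon_H$.
   Context: Sweedler notation $\Delta(f)=f_{(1)}\otimes f_{(2)}$ is used; $\varepsilon,\eta,\mathcal S$ denote counit, unit and antipode. (In the formula, $B(f_{(2)})_{(1)}\otimes B(f_{(2)})_{(2)}=\Delta_K(B(f_{(2)}))$.) A right Hopf module $(H,\lhd,K)$ consists of cocommutative Hopf algebras $H,K$ and a linear map $\lhd\colon H\otimes K\to H$ which is a morphism of coalgebras, i.e. $(h\lhd k)_{(1)}\otimes(h\lhd k)_{(2)}=(h_{(1)}\lhd k_{(1)})\otimes(h_{(2)}\lhd k_{(2)})$ and $\varepsilon_H(h\lhd k)=\varepsilon_H(h)\varepsilon_K(k)$, such that for all $h,h_1,h_2\in H$, $k,k_1,k_2\in K$: $(h\lhd k_1)\lhd k_2=h\lhd(k_1k_2)$, $(h_1h_2)\lhd k=(h_1\lhd k_{(1)})(h_2\lhd k_{(2)})$, $h\lhd 1=h$, $1\lhd k=\varepsilon_K(k)1$. *)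

(* Defs.v *)
From HB Require Import structures.
From mathcomp Require Import all_boot all_order all_algebra.
From mathcomp Require Import generic_quotient sesquilinear boolp.

Set Implicit Arguments.
Unset Strict Implicit.
Unset Printing Implicit Defensive.

Import GRing.Theory.
Local Open Scope ring_scope.
Local Open Scope quotient_scope.

Reserved Notation "x \ox y" (at level 40, left associativity).
Reserved Notation "'\sw_' ( x , y <- t ) e"
  (at level 41, x binder, y binder, t at level 100, e at level 41,
   format "'[' '\sw_' ( x ,  y  <-  t ) '/  '  e ']'").

(* The tensor product of V and W is the quotient of the formal sums of pairs
   (a list s stands for the sum of v (x) w over the (v, w) in s) by the
   congruence generated by the bilinearity relations. *)
Section TensorRelation.
Variables (F : fieldType) (V W : lmodType F).

Inductive tensor_rel : seq (V * W) -> seq (V * W) -> Prop :=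
| tensor_refl s : tensor_rel s s
| tensor_sym s t : tensor_rel s t -> tensor_rel t s
| tensor_trans s t u : tensor_rel s t -> tensor_rel t u -> tensor_rel s u
| tensor_cat s s' t t' :
    tensor_rel s s' -> tensor_rel t t' -> tensor_rel (s ++ t) (s' ++ t')
| tensor_catC s t : tensor_rel (s ++ t) (t ++ s)
| tensor_addl v v' w : tensor_rel [:: (v + v', w)] [:: (v, w); (v', w)]
| tensor_addr v w w' : tensor_rel [:: (v, w + w')] [:: (v, w); (v, w')]
| tensor_scale a v w : tensor_rel [:: (a *: v, w)] [:: (v, a *: w)]
| tensor_zero : tensor_rel [:: (0, 0)] [::].

Definition tensor_relb (s t : seq (V * W)) : bool := `[< tensor_rel s t >].

Lemma tensor_relb_refl : reflexive tensor_relb.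
Proof. by move=> s; apply/asboolP; exact: tensor_refl. Qed.

Lemma tensor_relb_sym : symmetric tensor_relb.
Proof. by move=> s t; apply/asboolP/asboolP; exact: tensor_sym. Qed.

Lemma tensor_relb_trans : transitive tensor_relb.
Proof.
move=> t s u /asboolP st /asboolP tu; apply/asboolP; exact: tensor_trans st tu.
Qed.

Canonical tensor_equiv :=
  EquivRel tensor_relb tensor_relb_refl tensor_relb_sym tensor_relb_trans.

Definition tensor := {eq_quot tensor_equiv}.

HB.instance Definition _ := Choice.on tensor.
HB.instance Definition _ := EqQuotient.on tensor.

Lemma tensor_eqP (s t : seq (V * W)) :
  \pi_tensor s = \pi_tensor t <-> tensor_rel s t.
Proof.
split=> [/eqmodP/asboolP //|st]; apply/eqmodP; exact/asboolP.
Qed.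

Lemma tensor_piP (t : tensor) : exists s, t = \pi_tensor s.
Proof. by exists (repr t); rewrite reprK. Qed.

Lemma tensor_reprP (s : seq (V * W)) : tensor_rel (repr (\pi_tensor s)) s.
Proof. by apply/tensor_eqP; rewrite reprK. Qed.

Lemma tensor_rel0l w : tensor_rel [:: (0, w)] [::].
Proof.
apply: tensor_trans tensor_zero.
rewrite -{1}(scale0r (0 : V)) -[in X in tensor_rel _ X](scale0r w).
exact: tensor_scale.
Qed.

Definition tensor0 : tensor := \pi_tensor [::].
Definition tensor_add (x y : tensor) : tensor := \pi_tensor (repr x ++ repr y).
Definition tensor_scal (a : F) (x : tensor) : tensor :=
  \pi [seq (a *: p.1, p.2) | p <- repr x].

Definition pure (v : V) (w : W) : tensor := \pi_tensor [:: (v, w)].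

Lemma tensor_add_pi s t : tensor_add (\pi_tensor s) (\pi_tensor t) = \pi_tensor (s ++ t).
Proof.
apply/tensor_eqP; apply: tensor_cat; exact: tensor_reprP.
Qed.

Lemma tensor_rel_scal a s t : tensor_rel s t ->
  tensor_rel [seq (a *: p.1, p.2) | p <- s] [seq (a *: p.1, p.2) | p <- t].
Proof.
elim=> {s t}.
- by move=> s; exact: tensor_refl.
- by move=> s t _; exact: tensor_sym.
- by move=> s t u _ st _; exact: tensor_trans.
- by move=> s s' t t' _ ss' _ tt'; rewrite !map_cat; exact: tensor_cat.
- by move=> s t; rewrite !map_cat; exact: tensor_catC.
- by move=> v v' w /=; rewrite scalerDr; exact: tensor_addl.
- by move=> v w w' /=; exact: tensor_addr.
- move=> b v w /=; rewrite scalerA mulrC -scalerA; exact: tensor_scale.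
- by rewrite /= scaler0; exact: tensor_zero.
Qed.

Lemma tensor_scal_pi a s :
  tensor_scal a (\pi_tensor s) = \pi_tensor [seq (a *: p.1, p.2) | p <- s].
Proof. apply/tensor_eqP; apply: tensor_rel_scal; exact: tensor_reprP. Qed.

Lemma tensor_addA : associative tensor_add.
Proof.
move=> x y z; have [s ->] := tensor_piP x; have [t ->] := tensor_piP y; have [u ->] := tensor_piP z.
by rewrite !tensor_add_pi catA.
Qed.

Lemma tensor_addC : commutative tensor_add.
Proof.
move=> x y; have [s ->] := tensor_piP x; have [t ->] := tensor_piP y; rewrite !tensor_add_pi.
apply/tensor_eqP; exact: tensor_catC.
Qed.

Lemma tensor_add0 : left_id tensor0 tensor_add.
Proof. by move=> x; have [s ->] := tensor_piP x; rewrite tensor_add_pi. Qed.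

Lemma tensor_rel_shuffle x y s t :
  tensor_rel ([:: x; y] ++ s ++ t) ((x :: s) ++ y :: t).
Proof.
have yst : tensor_rel (([:: y] ++ s) ++ t) ((s ++ [:: y]) ++ t).
  by apply: tensor_cat (tensor_catC _ _) (tensor_refl _).
have := tensor_cat (tensor_refl [:: x]) yst.
by rewrite -!catA.
Qed.

Lemma tensor_scalDl (t : tensor) (a b : F) :
  tensor_scal (a + b) t = tensor_add (tensor_scal a t) (tensor_scal b t).
Proof.
have [s ->] := tensor_piP t; rewrite !tensor_scal_pi tensor_add_pi; apply/tensor_eqP.
elim: s => [|[v w] s IHs] /=; first exact: tensor_refl.
rewrite -cat1s scalerDl.
apply: tensor_trans (tensor_cat (tensor_addl _ _ _) IHs) _.
exact: tensor_rel_shuffle.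
Qed.

Lemma tensor_scal1 : left_id 1 tensor_scal.
Proof.
move=> x; have [s ->] := tensor_piP x; rewrite tensor_scal_pi; congr (\pi_tensor _).
by elim: s => [//|[v w] s /= ->]; rewrite scale1r.
Qed.

Lemma tensor_scalA (a b : F) (t : tensor) :
  tensor_scal a (tensor_scal b t) = tensor_scal (a * b) t.
Proof.
have [s ->] := tensor_piP t; rewrite !tensor_scal_pi -map_comp; congr (\pi_tensor _).
by apply: eq_map => -[v w] /=; rewrite scalerA.
Qed.

Lemma tensor_scalDr : right_distributive tensor_scal tensor_add.
Proof.
move=> a x y; have [s ->] := tensor_piP x; have [t ->] := tensor_piP y.
by rewrite tensor_add_pi !tensor_scal_pi tensor_add_pi map_cat.
Qed.

Lemma tensor_scal0 (t : tensor) : tensor_scal 0 t = tensor0.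
Proof.
have [s ->] := tensor_piP t; rewrite tensor_scal_pi; apply/tensor_eqP.
elim: s => [|[v w] s IHs] /=; first exact: tensor_refl.
rewrite scale0r; exact: (tensor_cat (tensor_rel0l w) IHs).
Qed.

Definition tensor_opp := tensor_scal (-1).

Lemma tensor_addN : left_inverse tensor0 tensor_opp tensor_add.
Proof.
by move=> t; rewrite -{2}(tensor_scal1 t) -tensor_scalDl addNr tensor_scal0.
Qed.

HB.instance Definition _ := GRing.isZmodule.Build tensor
  tensor_addA tensor_addC tensor_add0 tensor_addN.

HB.instance Definition _ := GRing.Zmodule_isLmodule.Build F tensor
  tensor_scalA tensor_scal1 tensor_scalDr tensor_scalDl.

End TensorRelation.

Notation "x \ox y" := (pure x y) : ring_scope.

(* Sweedler sums: when t is the sum of the v_i \ox w_i, \sw_(x, y <- t) f x y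
   is the sum of the f v_i w_i. For bilinear f this does not depend on the
   chosen representative of t (tlift_pure and tlift_linear below); every use
   below is with an expression that is bilinear in (x, y). *)
Definition tlift (F : fieldType) (V W : lmodType F) (U : nmodType)
    (f : V -> W -> U) (t : tensor V W) : U :=
  \sum_(p <- repr t) f p.1 p.2.

Notation "'\sw_' ( x , y <- t ) e" := (tlift (fun x y => e) t) : ring_scope.

Section TensorTheory.
Variables (F : fieldType) (V W : lmodType F).

Lemma pure_bilinear : bilinear_for *:%R *:%R (@pure F V W).
Proof.
have scalE a (v : V) (w : W) : a *: (v \ox w) = (a *: v) \ox w.
  by rewrite -[LHS]/(tensor_scal _ _) tensor_scal_pi.
split=> [w a v v'|v a w w']; rewrite /= scalE -[RHS]/(tensor_add _ _) tensor_add_pi.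
  by apply/tensor_eqP; exact: tensor_addl.
apply/tensor_eqP; apply: tensor_trans (tensor_addr _ _ _) _.
apply: (@tensor_cat _ _ _ [:: _] _ [:: _]); last exact: tensor_refl.
by apply: tensor_sym; exact: tensor_scale.
Qed.

Lemma pi_sum_pure (s : seq (V * W)) :
  \pi_(tensor V W) s = \sum_(p <- s) p.1 \ox p.2.
Proof.
elim: s => [|[v w] s IHs]; first by rewrite big_nil.
by rewrite big_cons -IHs -[RHS]/(tensor_add _ _) tensor_add_pi.
Qed.

Lemma tensor_sum_pure (t : tensor V W) : t = \sw_(v, w <- t) v \ox w.
Proof. by rewrite -{1}(reprK t) pi_sum_pure. Qed.

Variables (U : lmodType F) (f : V -> W -> U).
Hypothesis f_bil : bilinear_for *:%R *:%R f.

Lemma tlift_rel s t : tensor_rel s t ->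
  \sum_(p <- s) f p.1 p.2 = \sum_(p <- t) f p.1 p.2.
Proof.
have [fl fr] := f_bil.
elim=> {s t} //.
- by move=> s t u _ -> _ ->.
- by move=> s s' t t' _ ss' _ tt'; rewrite !big_cat ss' tt'.
- by move=> s t; rewrite !big_cat /= addrC.
- move=> v v' w; rewrite !big_cons big_nil /= !addr0.
  by rewrite -[v in LHS]scale1r fl /= scale1r.
- move=> v w w'; rewrite !big_cons big_nil /= !addr0.
  by rewrite -[w in LHS]scale1r fr /= scale1r.
- move=> a v w; rewrite !big_cons big_nil /= !addr0.
  by rewrite (scalable_linear (fl w)) (scalable_linear (fr v)).
- rewrite big_cons !big_nil addr0 /=.
  by have := scalable_linear (fl 0) 0 0; rewrite /= !scale0r => ->.
Qed.

Lemma tlift_pi s : tlift f (\pi_(tensor V W) s) = \sum_(p <- s) f p.1 p.2.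
Proof. by apply: tlift_rel; exact: tensor_reprP. Qed.

Lemma tlift_pure v w : tlift f (v \ox w) = f v w.
Proof. by rewrite tlift_pi big_seq1. Qed.

Lemma tlift_linear : linear (tlift f).
Proof.
move=> a x y; have [s ->] := tensor_piP x; have [t ->] := tensor_piP y.
rewrite -[a *: _]/(tensor_scal _ _) -[tensor_scal _ _ + _]/(tensor_add _ _).
rewrite tensor_scal_pi tensor_add_pi !tlift_pi big_cat big_map scaler_sumr.
congr (_ + _); apply: eq_bigr => p _ /=.
exact: (scalable_linear (f_bil.1 p.2)).
Qed.

End TensorTheory.

HB.mixin Record Lmodule_isCoalgebra (F : fieldType) C of GRing.Lmodule F C := {
  comult : {linear C -> tensor C C};
  counit : {scalar C};
  comultA : forall c : C,
    \sw_(c1, c2 <- comult c) \sw_(c11, c12 <- comult c1) c11 \ox (c12 \ox c2) =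
    \sw_(c1, c2 <- comult c) c1 \ox comult c2;
  counitl : forall c : C, \sw_(c1, c2 <- comult c) (counit c1 *: c2) = c;
  counitr : forall c : C, \sw_(c1, c2 <- comult c) (counit c2 *: c1) = c
}.

#[short(type="coalgType")]
HB.structure Definition Coalgebra (F : fieldType) :=
  {C of Lmodule_isCoalgebra F C & GRing.Lmodule F C}.

HB.mixin Record isHopfAlgebra (F : fieldType) H
    of GRing.Algebra F H & Coalgebra F H := {
  comult1 : comult (1 : H) = 1 \ox 1;
  comultM : forall x y : H, comult (x * y) =
    \sw_(x1, x2 <- comult x) \sw_(y1, y2 <- comult y) (x1 * y1) \ox (x2 * y2);
  counit1 : counit (1 : H) = 1 :> F;
  counitM : forall x y : H, counit (x * y) = counit x * counit y :> F;
  antipode : {linear H -> H};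
  antipodel : forall x : H,
    \sw_(x1, x2 <- comult x) (antipode x1 * x2) = (counit x)%:A;
  antipoder : forall x : H,
    \sw_(x1, x2 <- comult x) (x1 * antipode x2) = (counit x)%:A
}.

#[short(type="hopfAlgType")]
HB.structure Definition HopfAlgebra (F : fieldType) :=
  {H of isHopfAlgebra F H & GRing.Algebra F H & Coalgebra F H}.

HB.mixin Record Coalgebra_isCocommutative (F : fieldType) C
    of Coalgebra F C := {
  comultC : forall c : C, \sw_(c1, c2 <- comult c) c2 \ox c1 = comult c
}.

#[short(type="cocommHopfAlgType")]
HB.structure Definition CocommHopfAlgebra (F : fieldType) :=
  {H of HopfAlgebra F H & Coalgebra_isCocommutative F H}.

Record rightHopfModule (F : fieldType) (H K : cocommHopfAlgType F) := {
  ract_tensor : {linear tensor H K -> H};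
  ract := fun h k => ract_tensor (h \ox k);
  comult_ract : forall h k, comult (ract h k) =
    \sw_(h1, h2 <- comult h) \sw_(k1, k2 <- comult k)
      ract h1 k1 \ox ract h2 k2;
  counit_ract : forall h k, counit (ract h k) = counit h * counit k :> F;
  ractA : forall h k1 k2, ract (ract h k1) k2 = ract h (k1 * k2);
  ractMl : forall h1 h2 k, ract (h1 * h2) k =
    \sw_(k1, k2 <- comult k) (ract h1 k1 * ract h2 k2);
  ract1 : forall h, ract h 1 = h;
  ract1l : forall k, ract 1 k = (counit k)%:A
}.

Section LinearMaps.
Variables (F : fieldType) (U V : lmodType F).
Implicit Types A B C : {linear U -> V}.

HB.instance Definition _ := gen_eqMixin {linear U -> V}.
HB.instance Definition _ := gen_choiceMixin {linear U -> V}.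

Lemma linear_mapP A B : A =1 B -> A = B.
Proof.
case: A B => f cf [g cg] /= /funext fg; subst g; congr GRing.Linear.Pack.
case: cf cg => -[add_f] [lin_f] [[add_g] [lin_g]].
by rewrite (Prop_irrelevance add_f add_g) (Prop_irrelevance lin_f lin_g).
Qed.

Definition linear_zero : {linear U -> V} := \0.
Definition linear_add A B : {linear U -> V} := A \+ B.
Definition linear_opp A : {linear U -> V} := \- A.
Definition linear_scale a A : {linear U -> V} := a \*: A.

Lemma linear_addA : associative linear_add.
Proof. by move=> A B C; apply: linear_mapP => x /=; rewrite addrA. Qed.

Lemma linear_addC : commutative linear_add.
Proof. by move=> A B; apply: linear_mapP => x /=; rewrite addrC. Qed.

Lemma linear_add0 : left_id linear_zero linear_add.
Proof. by move=> A; apply: linear_mapP => x /=; rewrite add0r. Qed.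

Lemma linear_addN : left_inverse linear_zero linear_opp linear_add.
Proof. by move=> A; apply: linear_mapP => x /=; rewrite addNr. Qed.

HB.instance Definition _ := GRing.isZmodule.Build {linear U -> V}
  linear_addA linear_addC linear_add0 linear_addN.

Lemma linear_scaleA a b A :
  linear_scale a (linear_scale b A) = linear_scale (a * b) A.
Proof. by apply: linear_mapP => x /=; rewrite scalerA. Qed.

Lemma linear_scale1 : left_id 1 linear_scale.
Proof. by move=> A; apply: linear_mapP => x /=; rewrite scale1r. Qed.

Lemma linear_scaleDr : right_distributive linear_scale +%R.
Proof. by move=> a A B; apply: linear_mapP => x /=; rewrite scalerDr. Qed.

Lemma linear_scaleDl A :
  {morph linear_scale^~ A : a b / a + b >-> a + b}.
Proof. by move=> a b; apply: linear_mapP => x /=; rewrite scalerDl. Qed.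

HB.instance Definition _ := GRing.Zmodule_isLmodule.Build F {linear U -> V}
  linear_scaleA linear_scale1 linear_scaleDr linear_scaleDl.

End LinearMaps.

Section ConvolutionUnit.
Variables (F : fieldType) (C : coalgType F) (L : algType F).

Definition conv_unit_fun (c : C) : L := (counit c)%:A.

Lemma conv_unit_fun_linear : linear conv_unit_fun.
Proof.
by move=> a x y; rewrite /conv_unit_fun linearP scalerDl scalerA.
Qed.

HB.instance Definition _ :=
  GRing.isLinear.Build F C L *:%R conv_unit_fun conv_unit_fun_linear.

Definition conv_unit : {linear C -> L} := conv_unit_fun.

End ConvolutionUnit.

Section Hash.
Variables (F : fieldType) (H K : cocommHopfAlgType F).
Variable (M : rightHopfModule H K).

Lemma ract_bilinear : bilinear_for *:%R *:%R (ract M).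
Proof.
have [pl pr] := @pure_bilinear F H K.
by split=> [k a h h'|h a k k']; rewrite /= /ract ?pl ?pr /= linearP.
Qed.

Definition hash_fun (A B : {linear H -> K}) (f : H) : K :=
  \sw_(f1, f2 <- comult f) \sw_(b1, b2 <- comult (B f2))
    (A (ract M f1 (antipode b1)) * b2).

Lemma hash_fun_linear A B : linear (hash_fun A B).
Proof.
have [rl rr] := ract_bilinear.
move=> c f f'; rewrite /hash_fun linearP tlift_linear //.
split=> [f2 a f1 f1'|f1 a f2 f2'] /=.
  rewrite /tlift scaler_sumr -big_split /=; apply: eq_bigr => p _.
  by rewrite rl linearP mulrDl scalerAl.
rewrite !linearP tlift_linear //; split=> [b2 a' b1 b1'|b1 a' b2 b2'] /=.
  by rewrite linearP rr linearP mulrDl scalerAl.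
by rewrite mulrDr scalerAr.
Qed.

HB.instance Definition _ A B :=
  GRing.isLinear.Build F H K *:%R (hash_fun A B) (hash_fun_linear A B).

Definition hash (A B : {linear H -> K}) : {linear H -> K} := hash_fun A B.

End Hash.

(* Main.v *)
(* Write b for B(f2 <| S c1) and c for C(f3). Since S is antimultiplicative and
   comultiplicative (K being cocommutative) and <| is a morphism of coalgebras,
   both (A # B) # C and A # (B # C) send f to
     A(f1 <| S(b1 c2)) b2 c3,
   up to a permutation of the legs of c allowed by cocommutativity. The two
   properties of S come from uniqueness of convolution inverses, in the form of
   conv_antipode_cancel: if f * id = g then f = g * S. *)
Require Import Defs.
From mathcomp Require Import all_boot all_algebra.
From mathcomp Require Import sesquilinear.

Set Implicit Arguments.
Unset Strict Implicit.
Unset Printing Implicit Defensive.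

Import GRing.Theory.
Local Open Scope ring_scope.

(** * Linearity of Sweedler expressions *)

(* Unlike [linear f], which unfolds to a product, a goal [lin f] can be
   recognized syntactically by the tactic [lin_solve] below. *)
Definition lin (F : fieldType) (U V : lmodType F) (f : U -> V) : Prop :=
  linear f.

Section Linearity.
Variable F : fieldType.
Implicit Types U V W X : lmodType F.

Lemma lin_id U : lin (fun x : U => x).
Proof. by []. Qed.

Lemma lin_linear U V W (L : {linear V -> W}) (f : U -> V) :
  lin f -> lin (fun x => L (f x)).
Proof. by move=> lf a x y; rewrite lf linearP. Qed.

Lemma lin_comp U V W (g : V -> W) (f : U -> V) :
  lin g -> lin f -> lin (fun x => g (f x)).
Proof. by move=> lg lf a x y; rewrite lf lg. Qed.

Lemma lin_scalel U V (f : U -> F^o) (v : V) :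
  lin f -> lin (fun x => (f x : F) *: v).
Proof. by move=> lf b x y; rewrite lf scalerDl -scalerA. Qed.

Lemma lin_mull U (L : algType F) (f : U -> L) l :
  lin f -> lin (fun x => f x * l).
Proof. by move=> lf a x y; rewrite lf mulrDl scalerAl. Qed.

Lemma lin_mulr U (L : algType F) (f : U -> L) l :
  lin f -> lin (fun x => l * f x).
Proof. by move=> lf a x y; rewrite lf mulrDr scalerAr. Qed.

Lemma lin_purel U V W (f : U -> V) (w : W) :
  lin f -> lin (fun x => f x \ox w).
Proof. by move=> lf a x y; rewrite lf (pure_bilinear V W).1. Qed.

Lemma lin_purer U V W (f : U -> W) (v : V) :
  lin f -> lin (fun x => v \ox f x).
Proof. by move=> lf a x y; rewrite lf (pure_bilinear V W).2. Qed.

Lemma lin_tlift_id V W X (f : V -> W -> X) :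
  (forall w, lin (f^~ w)) -> (forall v, lin (f v)) -> lin (tlift f).
Proof. by move=> fl fr a x y; rewrite tlift_linear. Qed.

Lemma tlift_pure_lin V W X (f : V -> W -> X) v w :
    (forall w, lin (f^~ w)) -> (forall v, lin (f v)) ->
  tlift f (v \ox w) = f v w.
Proof. by move=> fl fr; apply: tlift_pure; split. Qed.

Lemma lin_tlift U V W X (f : V -> W -> X) (t : U -> tensor V W) :
  (forall w, lin (f^~ w)) -> (forall v, lin (f v)) -> lin t ->
  lin (fun x => tlift f (t x)).
Proof. by move=> fl fr lt a x y; rewrite lt tlift_linear. Qed.

(** As [t] is fixed, every [x] sums over the same list [repr t], so linearity holds term by term. *)
Lemma lin_tlift_fun U V W X (f : U -> V -> W -> X) (t : tensor V W) :
  (forall v w, lin (fun x => f x v w)) -> lin (fun x => tlift (f x) t).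
Proof.
move=> lf a x y; rewrite /tlift scaler_sumr -big_split /=.
by apply: eq_bigr => p _; rewrite lf.
Qed.

Lemma lin0 U V (f : U -> V) : lin f -> f 0 = 0.
Proof.
by move=> lf; have := lf (-1) 0 0; rewrite scaler0 add0r scaleN1r addNr.
Qed.

Lemma linD U V (f : U -> V) : lin f -> {morph f : x y / x + y}.
Proof. by move=> lf x y; have := lf 1 x y; rewrite !scale1r. Qed.

Lemma linZ U V (f : U -> V) a x : lin f -> f (a *: x) = a *: f x.
Proof. by move=> lf; have := lf a x 0; rewrite (lin0 lf) !addr0. Qed.

Lemma tlift_ext V W (X : nmodType) (f g : V -> W -> X) t :
  (forall v w, f v w = g v w) -> tlift f t = tlift g t.
Proof. by move=> fg; apply: eq_bigr. Qed.

Lemma tlift_swap V W V' W' (X : nmodType) (f : V -> W -> V' -> W' -> X) s t :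
  \sw_(v, w <- s) \sw_(v', w' <- t) f v w v' w' =
  \sw_(v', w' <- t) \sw_(v, w <- s) f v w v' w'.
Proof. exact: exchange_big. Qed.

Lemma lin_sw V W X (Y : lmodType F) (L : X -> Y) (f : V -> W -> X) t : lin L ->
  L (\sw_(v, w <- t) f v w) = \sw_(v, w <- t) L (f v w).
Proof. by move=> lL; apply: (big_morph L (linD lL) (lin0 lL)). Qed.

End Linearity.

(** Linearity of [ract] is reached by unfolding it to [ract_tensor] on a pure tensor, through
    [lin_linear] and the rules for [\ox]. *)
Ltac lin_solve := lazymatch goal with
  | |- forall _, _ => intro; lin_solve
  | |- lin _ => cbv beta; first
    [ assumption | exact: lin_id
    | match goal with H : _ |- _ => solve [apply: H] end
    | apply: lin_mull; lin_solve | apply: lin_mulr; lin_solve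
    | apply: lin_purel; lin_solve | apply: lin_purer; lin_solve
    | apply: lin_scalel; lin_solve
    | apply: lin_tlift; lin_solve
    | apply: lin_tlift_fun; lin_solve
    | apply: lin_linear; lin_solve ]
  | |- _ => done
  end.

(** * Coalgebra axioms as rewriting rules for Sweedler sums *)

Section Coalgebra.
Variables (F : fieldType) (C : coalgType F) (V : lmodType F).
Implicit Types (c : C).

Lemma sw_coassoc (g : C -> C -> C -> V) c :
    (forall y z, lin (fun x => g x y z)) ->
    (forall x z, lin (fun y => g x y z)) ->
    (forall x y, lin (fun z => g x y z)) ->
  \sw_(c1, c2 <- comult c) \sw_(c11, c12 <- comult c1) g c11 c12 c2 =
  \sw_(c1, c2 <- comult c) \sw_(c21, c22 <- comult c2) g c1 c21 c22.
Proof.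
move=> g1 g2 g3.
pose G (x : C) (t : tensor C C) := \sw_(y, z <- t) g x y z.
have Gl t : lin (G^~ t) by rewrite /G; lin_solve.
have Gr x : lin (G x) by rewrite /G; lin_solve.
have lG : lin (tlift G) by apply: lin_tlift_id.
have := congr1 (tlift G) (comultA c).
rewrite (lin_sw _ _ lG) (lin_sw _ _ lG) => eqG.
transitivity (\sw_(c1, c2 <- comult c) tlift G (c1 \ox comult c2)).
  rewrite -eqG; apply: tlift_ext => c1 c2; rewrite (lin_sw _ _ lG).
  apply: tlift_ext => c11 c12.
  by rewrite tlift_pure_lin // /G tlift_pure_lin; lin_solve.
by apply: tlift_ext => c1 c2; rewrite tlift_pure_lin; lin_solve.
Qed.

Lemma sw_counitl (g : C -> V) c : lin g ->
  \sw_(c1, c2 <- comult c) ((counit c1 : F) *: g c2) = g c.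
Proof.
move=> lg; rewrite -{2}(counitl c) (lin_sw _ _ lg).
by apply: tlift_ext => c1 c2; rewrite linZ.
Qed.

Lemma sw_counitr (g : C -> V) c : lin g ->
  \sw_(c1, c2 <- comult c) ((counit c2 : F) *: g c1) = g c.
Proof.
move=> lg; rewrite -{2}(counitr c) (lin_sw _ _ lg).
by apply: tlift_ext => c1 c2; rewrite linZ.
Qed.

End Coalgebra.

Lemma sw_cocomm (F : fieldType) (K : cocommHopfAlgType F) (V : lmodType F)
    (g : K -> K -> V) c :
    (forall y, lin (g^~ y)) -> (forall x, lin (g x)) ->
  \sw_(c1, c2 <- comult c) g c2 c1 = \sw_(c1, c2 <- comult c) g c1 c2.
Proof.
move=> gl gr; have lg : lin (tlift g) by apply: lin_tlift_id.
rewrite -[in RHS](comultC c) (lin_sw _ _ lg).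
by apply: tlift_ext => c1 c2; rewrite tlift_pure_lin; lin_solve.
Qed.

(** * The antipode *)

Section Antipode.
Variables (F : fieldType) (K : hopfAlgType F).
Local Notation S := (@antipode F K).

Lemma counit_lin : lin (counit : K -> F^o).
Proof. exact: linearP. Qed.

Lemma sw_comultM (V : lmodType F) (g : K -> K -> V) x y :
    (forall y, lin (g^~ y)) -> (forall x, lin (g x)) ->
  tlift g (comult (x * y)) =
  \sw_(x1, x2 <- comult x) \sw_(y1, y2 <- comult y) g (x1 * y1) (x2 * y2).
Proof.
move=> gl gr; have lg : lin (tlift g) by apply: lin_tlift_id.
rewrite comultM (lin_sw _ _ lg); apply: tlift_ext => x1 x2.
by rewrite (lin_sw _ _ lg); apply: tlift_ext => y1 y2; rewrite tlift_pure_lin.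
Qed.

Lemma antipode1 : S 1 = 1.
Proof.
have := antipodel (1 : K).
by rewrite comult1 tlift_pure_lin ?counit1 ?scale1r ?mulr1 //; lin_solve.
Qed.

(** Apply the counit to [antipodel]: the sum of eps(S x1) eps(x2) is eps(x), and the counit axiom
    collapses that sum to eps(S x). *)
Lemma counit_antipode x : counit (S x) = counit x :> F.
Proof.
have := congr1 (counit : K -> F^o) (antipodel x).
rewrite (lin_sw _ _ counit_lin) (linZ _ _ counit_lin) counit1 => e.
have /= e2 : \sw_(c1, c2 <- comult x) ((counit c2 : F) *: (counit (S c1) : F^o))
  = counit (S x).
  by apply: (@sw_counitr F K F^o (fun z => counit (S z))); lin_solve.
rewrite -e2; move: e; rewrite [_ *: 1]mulr1 => <-.
by apply: tlift_ext => c1 c2; rewrite counitM mulrC.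
Qed.

(* V is a right K-module, so that linear maps K -> V can be convolved on the
   right with id and with S. *)
Lemma conv_antipode_cancel (V : lmodType F) (act : V -> K -> V) (f g : K -> V) :
    (forall k, lin (act^~ k)) -> (forall v, lin (act v)) -> lin f ->
    (forall v k l, act (act v k) l = act v (k * l)) ->
    (forall v, act v 1 = v) ->
    (forall x, \sw_(x1, x2 <- comult x) act (f x1) x2 = g x) ->
  forall x, f x = \sw_(x1, x2 <- comult x) act (g x1) (S x2).
Proof.
move=> al ar lf actA act1 fg x; symmetry.
(* With g = f * id the sum is (f * id) * S. Coassociativity regroups it as f * (id * S), and id * S
   is the convolution unit by [antipoder]. *)
transitivity (\sw_(x1, x2 <- comult x) \sw_(y1, y2 <- comult x1)
   act (act (f y1) y2) (S x2)).
  apply: tlift_ext => x1 x2; rewrite -fg.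
  by rewrite (lin_sw (L := fun v => act v (S x2))).
have lacc (U : lmodType F) (h : U -> V) k : lin h -> lin (fun u => act (h u) k).
  by move=> lh; apply: (lin_comp (al k)).
have laccr (U : lmodType F) (h : U -> K) v :
    lin h -> lin (fun u => act v (h u)).
  by move=> lh; apply: (lin_comp (ar v)).
rewrite (sw_coassoc (g := fun p q r => act (act (f p) q) (S r))); last 3 first.
- by move=> p q; apply: (lacc); apply: lacc.
- by move=> p q; apply: lacc.
- by move=> p q; apply: laccr; lin_solve.
rewrite -[RHS](sw_counitr (g := f)) //; apply: tlift_ext => x1 x2.
transitivity (act (f x1) (\sw_(y1, y2 <- comult x2) (y1 * S y2))).
  by rewrite (lin_sw (L := act (f x1))) //; apply: tlift_ext => y1 y2.
by rewrite antipoder linZ // act1.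
Qed.

(** [conv_antipode_cancel] is used once per factor: first in [w] with [z] fixed, where convolving
    with id gives [antipodel] at the product of the two arguments, then in [x] with [y] fixed, where
    it gives [step1]. *)
Lemma antipodeM x y : S (x * y) = S y * S x.
Proof.
have step1 z w :
    \sw_(z1, z2 <- comult z) (S (z1 * w) * z2) = (counit z : F) *: S w.
  rewrite (@conv_antipode_cancel K (fun u v => u * v)
    (fun w => \sw_(z1, z2 <- comult z) (S (z1 * w) * z2))
    (fun w => (counit z * counit w : F) *: 1)); try lin_solve.
  - rewrite -[RHS](sw_counitl (g := fun u => (counit z : F) *: S u)).
    2: lin_solve.
    by apply: tlift_ext => a b; rewrite -scalerAl mul1r scalerA mulrC.
  - by move=> *; rewrite mulrA.
  - by move=> *; rewrite mulr1.
  move=> u; rewrite -counitM -antipodel sw_comultM; try lin_solve.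
  rewrite tlift_swap; apply: tlift_ext => u1 u2.
  rewrite (lin_sw (L := fun t => t * u2)); last lin_solve.
  by apply: tlift_ext => z1 z2; rewrite mulrA.
rewrite (@conv_antipode_cancel K (fun u v => u * v)
    (fun x => S (x * y)) (fun x => (counit x : F) *: S y)); try lin_solve.
- rewrite -[RHS](sw_counitl (g := fun u => S y * S u)); last lin_solve.
  by apply: tlift_ext => a b; rewrite scalerAl.
- by move=> *; rewrite mulrA.
- by move=> *; rewrite mulr1.
Qed.

Lemma comult_antipode x :
  comult (S x) = \sw_(x1, x2 <- comult x) S x2 \ox S x1.
Proof.
(* Two right K-module structures on K (x) K, one for each leg. *)
pose R1 (t : tensor K K) k := \sw_(a, b <- t) (a * k) \ox b.
pose R2 (t : tensor K K) k := \sw_(a, b <- t) a \ox (b * k).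
have R1l k : lin (R1^~ k) by rewrite /R1; lin_solve.
have R1r t : lin (R1 t) by rewrite /R1; lin_solve.
have R2l k : lin (R2^~ k) by rewrite /R2; lin_solve.
have R2r t : lin (R2 t) by rewrite /R2; lin_solve.
have R1p a b k : R1 (a \ox b) k = (a * k) \ox b.
  by rewrite /R1 tlift_pure_lin //; lin_solve.
have R2p a b k : R2 (a \ox b) k = a \ox (b * k).
  by rewrite /R2 tlift_pure_lin //; lin_solve.
have R1A t k l : R1 (R1 t k) l = R1 t (k * l).
  rewrite {2}/R1 (lin_sw (L := R1^~ l)) //.
  by apply: tlift_ext => a b; rewrite R1p mulrA.
have R2A t k l : R2 (R2 t k) l = R2 t (k * l).
  rewrite {2}/R2 (lin_sw (L := R2^~ l)) //.
  by apply: tlift_ext => a b; rewrite R2p mulrA.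
have R11 t : R1 t 1 = t.
  by rewrite [RHS]tensor_sum_pure; apply: tlift_ext => a b; rewrite mulr1.
have R21 t : R2 t 1 = t.
  by rewrite [RHS]tensor_sum_pure; apply: tlift_ext => a b; rewrite mulr1.
have R1c (U : lmodType F) (h : U -> tensor K K) k :
    lin h -> lin (fun u => R1 (h u) k).
  by move=> lh; apply: (lin_comp (R1l k)).
have lF : lin (fun z => \sw_(z1, z2 <- comult z) R1 (comult (S z1)) z2).
  apply: lin_tlift; [|by []|lin_solve].
  by move=> k; apply: R1c; lin_solve.
(* The right action of a \ox b on K \ox K is R1 a followed by R2 b; Delta o S is
   a left inverse of Delta, and the two legs are moved across one at a time. *)
have step1 z : \sw_(z1, z2 <- comult z) R1 (comult (S z1)) z2 = 1 \ox S z.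
  rewrite (@conv_antipode_cancel (tensor K K) R2
    (fun z => \sw_(z1, z2 <- comult z) R1 (comult (S z1)) z2)
    (fun z => (counit z : F) *: (1 \ox 1))) //.
    rewrite -[RHS](sw_counitl (g := fun u => 1 \ox S u)); last lin_solve.
    by apply: tlift_ext => a b; rewrite (linZ _ _ (R2l _)) R2p mul1r.
  move=> u.
  transitivity (\sw_(u1, u2 <- comult u) \sw_(v1, v2 <- comult u1)
     R2 (R1 (comult (S v1)) v2) u2).
    by apply: tlift_ext => u1 u2; rewrite (lin_sw (L := R2^~ u2)).
  rewrite (sw_coassoc (g := fun p q r => R2 (R1 (comult (S p)) q) r)).
  - rewrite -comult1 -linearZ -antipodel /=.
    rewrite (lin_sw (L := comult)); last exact: linearP.
    apply: tlift_ext => u1 u2; rewrite comultM.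
    rewrite tlift_swap; apply: tlift_ext => v1 v2.
    rewrite /R1 (lin_sw (L := R2^~ v2)) //.
    by apply: tlift_ext => a b; rewrite R2p.
  - by move=> p q; apply: (lin_comp (R2l _)); apply: R1c; lin_solve.
  - by move=> p q; apply: (lin_comp (R2l _)).
  - by move=> p q; apply: R2r.
(* Now the left leg: [R1] lets S x2 act on 1 (x) S x1, which is why the legs come out reversed. *)
rewrite (@conv_antipode_cancel (tensor K K) R1
    (fun x => comult (S x)) (fun x => 1 \ox S x)) //; last by lin_solve.
by apply: tlift_ext => a b; rewrite R1p mul1r.
Qed.

End Antipode.

(** * The action twisted by the antipode, and the laws of the product [hash] *)

Section HashProduct.
Variables (F : fieldType) (H K : cocommHopfAlgType F).
Variable (M : rightHopfModule H K).

(** The action is a coalgebra morphism; the reversal of legs in [comult_antipode] is undone by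
    cocommutativity of K. *)
Lemma sw_ract_antipode (V : lmodType F) (g : H -> H -> V) h k :
    (forall y, lin (g^~ y)) -> (forall x, lin (g x)) ->
  tlift g (comult (ract M h (antipode k))) =
  \sw_(h1, h2 <- comult h) \sw_(k1, k2 <- comult k)
    g (ract M h1 (antipode k1)) (ract M h2 (antipode k2)).
Proof.
move=> gl gr; have lg : lin (tlift g) by apply: lin_tlift_id.
have gl' (U : lmodType F) (f : U -> H) y : lin f -> lin (fun u => g (f u) y).
  by move=> lf; apply: (lin_comp (gl y)).
have gr' (U : lmodType F) (f : U -> H) x : lin f -> lin (fun u => g x (f u)).
  by move=> lf; apply: (lin_comp (gr x)).
rewrite comult_ract (lin_sw _ _ lg); apply: tlift_ext => h1 h2.
pose G k1 k2 := g (ract M h1 k1) (ract M h2 k2).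
have Gl y : lin (G^~ y) by apply: gl'; lin_solve.
have Gr x : lin (G x) by apply: gr'; lin_solve.
have lG : lin (tlift G) by apply: lin_tlift_id.
transitivity (tlift G (comult (antipode k))).
  rewrite (lin_sw _ _ lg); apply: tlift_ext => k1 k2.
  by rewrite tlift_pure_lin.
rewrite comult_antipode (lin_sw _ _ lG).
rewrite (sw_cocomm (g := fun a b => tlift G (antipode a \ox antipode b))).
- by apply: tlift_ext => k1 k2; rewrite tlift_pure_lin.
- by move=> y; apply: (lin_comp lG); lin_solve.
- by move=> y; apply: (lin_comp lG); lin_solve.
Qed.

Lemma hash_linear_l B : lin (fun A => hash M A B).
Proof.
move=> a A A'; apply: linear_mapP => f /=; rewrite /hash_fun.
rewrite /tlift scaler_sumr -big_split /=; apply: eq_bigr => p _.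
rewrite scaler_sumr -big_split /=; apply: eq_bigr => q _.
by rewrite mulrDl scalerAl.
Qed.

Lemma hash_linear_r A : lin (hash M A).
Proof.
move=> a B B'; apply: linear_mapP => f /=; rewrite /hash_fun.
(* Changing [B] changes the representative of [comult (B f2)], so the inner sum is treated as a
   linear function of d = B f2. *)
have ld h : lin (fun d => \sw_(b1, b2 <- comult d)
                 (A (ract M h (antipode b1)) * b2)) by lin_solve.
rewrite /tlift scaler_sumr -big_split /=; apply: eq_bigr => p _.
exact: (ld p.1 a (B p.2) (B' p.2)).
Qed.

(** eps(f1 <| S b1) = eps(f1) eps(b1), and two counit axioms absorb these factors. *)
Lemma hash1l : left_id (conv_unit H K) (hash M).
Proof.
move=> B; apply: linear_mapP => f /=; rewrite /hash_fun.
rewrite -[RHS](sw_counitl (g := B)); last lin_solve.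
apply: tlift_ext => f1 f2.
rewrite -[in RHS](sw_counitl (g := id) (B f2)) //.
rewrite (lin_sw (L := fun v => _ *: v)); last lin_solve.
apply: tlift_ext => b1 b2.
rewrite /= /conv_unit_fun counit_ract counit_antipode.
by rewrite -scalerAl mul1r scalerA.
Qed.

(** Here B(f2) is a multiple of 1, and S 1 = 1 acts trivially. *)
Lemma hash1r : right_id (conv_unit H K) (hash M).
Proof.
move=> A; apply: linear_mapP => f /=; rewrite /hash_fun.
rewrite -[RHS](sw_counitr (g := A)); last lin_solve.
apply: tlift_ext => f1 f2.
rewrite /= /conv_unit_fun linearZ /= comult1.
rewrite (linZ (f := tlift _)); last by apply: lin_tlift; lin_solve.
by rewrite tlift_pure_lin ?antipode1 ?ract1 ?mulr1 //; lin_solve.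
Qed.

Lemma hashA : associative (hash M).
Proof.
move=> A B C; apply: linear_mapP => f /=; rewrite /hash_fun /=.
(* The common form, with the legs of c placed as (A # B) # C produces them: [c11] inside [A], [c12]
   inside [B]. *)
pose g p q r := \sw_(c1, c2 <- comult (C r)) \sw_(c11, c12 <- comult c1)
  \sw_(b1, b2 <- comult (B (ract M q (antipode c12))))
    (A (ract M p (antipode (b1 * c11))) * (b2 * c2)).
transitivity (\sw_(f1, f2 <- comult f) \sw_(f21, f22 <- comult f2)
  g f1 f21 f22).
  apply: tlift_ext => f1 f2; set G := fun _ => _.
  have lG : lin (fun d => tlift G (comult d)) by rewrite /G; lin_solve.
  rewrite /hash_fun (lin_sw _ _ lG); apply: tlift_ext => f21 f22.
  rewrite (lin_sw _ _ lG) /g.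
  (* A # (B # C) puts the first leg of c inside [B] and the second inside [A], so [c11] and [c12]
     are exchanged by cocommutativity. *)
  rewrite [RHS](_ : _ = \sw_(c1, c2 <- comult (C f22))
    \sw_(c11, c12 <- comult c1)
    \sw_(b1, b2 <- comult (B (ract M f21 (antipode c11))))
      (A (ract M f1 (antipode (b1 * c12))) * (b2 * c2))); last first.
    apply: tlift_ext => c1 c2; symmetry.
    pose h x y := \sw_(b1, b2 <- comult (B (ract M f21 (antipode x))))
      (A (ract M f1 (antipode (b1 * y))) * (b2 * c2)).
    by rewrite -[LHS]/(tlift h _) -(sw_cocomm (g := h)) // /h; lin_solve.
  rewrite (sw_coassoc (g := fun p q r =>
    \sw_(b1, b2 <- comult (B (ract M f21 (antipode p))))
      (A (ract M f1 (antipode (b1 * q))) * (b2 * r)))); try lin_solve.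
  apply: tlift_ext => c1 c2; rewrite /G sw_comultM; try lin_solve.
  exact: tlift_swap.
(* For (A # B) # C it is the first leg of f that is split again. *)
rewrite -(sw_coassoc (g := g)); try (rewrite /g; lin_solve).
apply: tlift_ext => f1 f2; rewrite /g tlift_swap.
apply: tlift_ext => c1 c2; rewrite /hash_fun.
rewrite sw_ract_antipode; try lin_solve.
rewrite (lin_sw (L := fun v => v * c2)); last lin_solve.
apply: tlift_ext => f11 f12.
rewrite (lin_sw (L := fun v => v * c2)); last lin_solve.
apply: tlift_ext => c11 c12.
rewrite (lin_sw (L := fun v => v * c2)); last lin_solve.
(* Acting by S c11 and then by S b1 is acting by S(b1 c11). *)
by apply: tlift_ext => b1 b2; rewrite ractA -antipodeM mulrA.
Qed.

End HashProduct.

Theorem mainTheorem1 (F : fieldType) (H K : cocommHopfAlgType F)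
    (M : rightHopfModule H K) :
  [/\ bilinear_for *:%R *:%R (hash M),
      associative (hash M),
      left_id (conv_unit H K) (hash M)
    & right_id (conv_unit H K) (hash M)].
Proof.
split; [|exact: hashA|exact: hash1l|exact: hash1r].
by split=> [B|A]; [exact: hash_linear_l | exact: hash_linear_r].
Qed.
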